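(* The set $A=\bigcup_{n=1}^{\infty}A_n$ is an uncountable subgroup of the additive group $\mathbb{R}$, and $A$ has Hausdorff dimension zero.
   Context: $\mathbb{N}$ denotes the positive integers and $\mathbb{N}_0$ the non-negative integers. For integers $a,b$ let $[a,b]_{\mathbb{Z}}=\{k\in\mathbb{Z}:a\le k\le b\}$. Let $S=\{0\}\cup\{2^n:n\in\mathbb{N}_0\}$, and for $n\in\mathbb{N}$ let $nS=\{s_1+\cdots+s_n: s_1,\ldots,s_n\in S\}$ be the $n$-th sumset. For $n\in\mathbb{N}$ define $$A_n=\left\{\sum_{k\in nS}\frac{x_k}{2^k}:\ \text{there exists } t\in\mathbb{N}\text{ such that } x_k\in[-t,t]_{\mathbb{Z}}\text{ for every } k\in nS\right\}\subseteq\mathbb{R}.$$ Hausdorff dimension is the usual one for subsets of $\mathbb{R}$: for $F\subseteq\mathbb{R}$, $s\ge 0$, $\delta>0$, $\mathcal{H}^s_\delta(F)$ is the infimum of $\sum_{B\in\mathcal{C}}d(B)^s$ over countable covers $\mathcal{C}$ of $F$ by subsets of $\mathbb{R}$ with diameter $d(B)\le\delta$; $\mathcal{H}^s(F)=\lim_{\delta\to0^+}\mathcal{H}^s_\delta(F)$; and the Hausdorff dimension of $F$ is the number $\alpha\in[0,1]$ such that $\mathcal{H}^s(F)=\infty$ for all $s\in[0,\alpha)$ and $\mathcal{H}^s(F)=0$ for all $s>\alpha$. *)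

(* Defs.v *)
From HB Require Import structures.
From mathcomp Require Import all_boot all_order all_algebra.
From mathcomp Require Import all_classical all_reals all_analysis.

Set Implicit Arguments.
Unset Strict Implicit.
Unset Printing Implicit Defensive.

Import Order.TTheory GRing.Theory Num.Theory.
Import numFieldNormedType.Exports.

Local Open Scope classical_set_scope.
Local Open Scope ring_scope.

Definition pow2_or_0 : set nat :=
  [set k | k = 0%N \/ exists n : nat, k = (2 ^ n)%N].

Definition sumset (S : set nat) (n : nat) : set nat :=
  [set k | exists s : 'I_n -> nat,
     (forall i, S (s i)) /\ k = (\sum_(i < n) s i)%N].

(* The digits x k with k outside the sumset are irrelevant.  The series
   converges absolutely since the digits are bounded, so that summing it in
   increasing order of the exponents is no restriction. *)
Definition A_ (R : realType) (n : nat) : set R :=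
  [set a | exists x : nat -> int,
     (exists2 t : nat, (0 < t)%N &
        forall k, sumset pow2_or_0 n k -> - t%:Z <= x k <= t%:Z) /\
     (\sum_(0 <= k < N | k \in sumset pow2_or_0 n) (x k)%:~R / 2 ^+ k : R)
       @[N --> \oo] --> a].

Arguments A_ R n : clear implicits.

Definition A_union (R : realType) : set R :=
  \bigcup_(n in [set n | (0 < n)%N]) A_ R n.

Arguments A_union R : clear implicits.

Section Hausdorff.
Context {R : realType}.
Local Open Scope ereal_scope.

(* The supremum is taken together with 0, so that the empty set has diameter
   0 and not -oo. *)
Definition diam (B : set R) : \bar R :=
  ereal_sup (0 |` [set `|x - y|%:E | x in B & y in B]).

Definition delta_cover (F : set R) (delta : R) (C : set (set R)) : Prop :=
  [/\ countable C, F `<=` \bigcup_(B in C) B &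
      forall B, C B -> diam B <= delta%:E].

(* For s = 0 this uses 0 `^ 0 = 1.  It does not matter that the empty set then
   contributes 1: it can be removed from any cover. *)
Definition hausdorff_premeasure (s delta : R) (F : set R) : \bar R :=
  ereal_inf [set \esum_(B in C) (diam B `^ s) | C in delta_cover F delta].

(* The limit exists: the premeasure is nonincreasing in delta. *)
Definition hausdorff_measure (s : R) (F : set R) : \bar R :=
  lim (hausdorff_premeasure s delta F @[delta --> 0%R^'+]).

Definition has_hausdorff_dim (F : set R) (alpha : R) : Prop :=
  [/\ (0 <= alpha <= 1)%R,
      forall s : R, (0 <= s < alpha)%R -> hausdorff_measure s F = +oo &
      forall s : R, (alpha < s)%R -> hausdorff_measure s F = 0].

End Hausdorff.

(* Main.v *)
(** [nS] has at most [(m+1)^n] elements below [2^m].  So the elements of [A_n]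
    with digits bounded by [t] are covered by [(2t+1)^((m+1)^n)] intervals of
    length [4t/2^(2^m)], whose [s]-th powers sum to an arbitrarily small number
    for every [s > 0], and [A] is a countable union of such sets.  It is
    uncountable since 0-1 sequences [e] inject into [A_1] by
    [e |-> \sum_i e_i / 2^(2^(i+1))], and it is a group since the sumsets [nS]
    increase with [n]. *)
Require Import Defs.
From HB Require Import structures.
From mathcomp Require Import all_boot all_order all_algebra.
From mathcomp Require Import all_classical all_reals all_analysis.
From mathcomp Require Import ring lra zify.

Set Implicit Arguments.
Unset Strict Implicit.
Unset Printing Implicit Defensive.

Import Order.TTheory GRing.Theory Num.Theory.
Import numFieldNormedType.Exports.

Local Open Scope classical_set_scope.
Local Open Scope ring_scope.

(** * Dyadic series with bounded digits: tails and convergence *)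

Section DyadicSeries.
Context {R : realType}.
Implicit Types (P Q : pred nat) (x y : nat -> int).

Definition dyadic_sum P x (N : nat) : R :=
  \sum_(0 <= k < N | P k) (x k)%:~R / 2 ^+ k.

Lemma dyadic_sumS P x N :
  dyadic_sum P x N.+1 =
  dyadic_sum P x N + (if P N then (x N)%:~R / 2 ^+ N else 0).
Proof.
by rewrite /dyadic_sum big_mkcond big_nat_recr //= -big_mkcond.
Qed.

Lemma dyadic_sumB P x y N :
  dyadic_sum P (fun k => x k - y k) N = dyadic_sum P x N - dyadic_sum P y N.
Proof.
rewrite /dyadic_sum -sumrB; apply: eq_bigr => k _.
by rewrite intrB mulrBl.
Qed.

Lemma dyadic_sum_widen P Q x N : (forall k, P k -> Q k) ->
  dyadic_sum Q (fun k => if P k then x k else 0) N = dyadic_sum P x N.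
Proof.
move=> PQ; rewrite /dyadic_sum big_mkcond [RHS]big_mkcond.
apply: eq_bigr => k _; case: ifP => [Qk|nQk].
  by case: ifP => // _; rewrite mul0r.
by case: ifP => // /PQ; rewrite nQk.
Qed.

Lemma sum_half_tail M N : (M <= N)%N ->
  \sum_(M <= k < N) (2 ^+ k)^-1 <= 2 / 2 ^+ M :> R.
Proof.
(* The exact value of the geometric sum is what the induction on [N] can carry; the bound then drops
   the subtracted term. *)
move=> MN; suff -> : \sum_(M <= k < N) (2 ^+ k)^-1 = 2 / 2 ^+ M - 2 / 2 ^+ N :> R.
  by rewrite gerBl divr_ge0 // exprn_ge0.
elim: N MN => [|N IH]; first by rewrite leqn0 => /eqP ->; rewrite big_geq// subrr.
rewrite leq_eqVlt => /predU1P[->|MN]; first by rewrite big_geq// subrr.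
rewrite big_nat_recr//= IH// [in RHS]exprS invfM mulrA divff// mul1r.
have : 2 ^+ N != 0 :> R by rewrite expf_neq0.
set u := (2 ^+ N); set v := 2 / 2 ^+ M => u0; lra.
Qed.

Lemma dyadic_sum_tail P x (t : nat) M N :
  (forall k, P k -> - t%:Z <= x k <= t%:Z) -> (M <= N)%N ->
  `|dyadic_sum P x N - dyadic_sum P x M| <= t%:R * (2 / 2 ^+ M).
Proof.
move=> xt MN.
have -> : dyadic_sum P x N - dyadic_sum P x M =
    \sum_(M <= k < N | P k) (x k)%:~R / 2 ^+ k.
  by rewrite /dyadic_sum (@big_cat_nat _ _ _ M 0 N)//= addrAC subrr add0r.
apply: (le_trans (ler_norm_sum _ _ _)).
apply: (@le_trans _ _ (\sum_(M <= k < N) t%:R * (2 ^+ k)^-1)); last first.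
  by rewrite -mulr_sumr ler_wpM2l// sum_half_tail.
rewrite big_mkcond; apply: ler_sum => k _; case: ifP => [Pk|_].
  rewrite normrM normfV normrX (ger0_norm (ler0n _ 2)).
  rewrite ler_wpM2r ?invr_ge0 ?exprn_ge0//.
  by rewrite -intr_norm -[t%:R]/(t%:Z%:~R) ler_int ler_norml xt.
by rewrite mulr_ge0 ?invr_ge0 ?exprn_ge0.
Qed.

(** This serves twice: as an approximation of [a] by finite sums, giving the radii of the covering
    balls, and with [a = 0] as a bound on a finite sum, giving injectivity on 0-1 sequences. *)
Lemma dyadic_lim_tail P x (t : nat) (a : R) M :
  (forall k, P k -> - t%:Z <= x k <= t%:Z) ->
  dyadic_sum P x N @[N --> \oo] --> a ->
  `|a - dyadic_sum P x M| <= t%:R * (2 / 2 ^+ M).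
Proof.
move=> xt xa.
have H : `|dyadic_sum P x N - dyadic_sum P x M| @[N --> \oo] -->
         `|a - dyadic_sum P x M|.
  by apply: cvg_norm; apply: cvgB => //; exact: cvg_cst.
rewrite -(cvg_lim _ H)//; apply: limr_le; first by apply/cvg_ex; eexists; exact: H.
by exists M => // N /= MN; exact: dyadic_sum_tail.
Qed.

(** Non-negative digits make the partial sums monotone, and the tail estimate from 0 bounds them. *)
Lemma dyadic_sum_cvg P x (t : nat) : (forall k, P k -> 0 <= x k <= t%:Z) ->
  cvgn (dyadic_sum P x).
Proof.
move=> xt; apply: nondecreasing_is_cvgn.
  apply/nondecreasing_seqP => N; rewrite dyadic_sumS lerDl.
  case: ifP => // PN; rewrite mulr_ge0 ?invr_ge0 ?exprn_ge0// ler0z.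
  by case/andP: (xt _ PN).
exists (t%:R * 2) => _ [N _ <-].
have xt' k : P k -> - t%:Z <= x k <= t%:Z.
  move=> /xt /andP[x0 ->]; rewrite andbT (le_trans _ x0)//; lia.
have := @dyadic_sum_tail _ _ _ 0%N N xt' (leq0n _).
rewrite expr0 divr1 {2}/dyadic_sum big_geq// subr0; apply: le_trans.
exact: ler_norm.
Qed.

End DyadicSeries.

(** * Monotonicity of the sumsets and the group structure *)

Lemma sumset_leq (S : set nat) m n : S 0%N -> (m <= n)%N ->
  sumset S m `<=` sumset S n.
Proof.
move=> S0; elim: n => [|n IH]; first by rewrite leqn0 => /eqP ->.
rewrite leq_eqVlt => /predU1P[-> //|mn] k /(IH mn)[s [sS ->]].
(* Pad with the summand 0 at the last index. *)
exists (fun i => if unlift ord_max i is Some j then s j else 0%N); split.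
  by move=> i; case: unliftP.
rewrite big_ord_recr/= unlift_none addn0; apply: eq_bigr => i _.
have -> : widen_ord (leqnSn n) i = lift ord_max i.
  by apply: val_inj; rewrite /= /bump leqNgt ltn_ord.
by rewrite liftK.
Qed.

Lemma pow2_or_0_0 : pow2_or_0 0%N. Proof. by left. Qed.

Section Subgroup.
Context {R : realType}.

Lemma A_mono m n : (m <= n)%N -> A_ R m `<=` A_ R n.
Proof.
move=> mn a [x [[t t0 xt] xa]].
have mS k : k \in sumset pow2_or_0 m -> k \in sumset pow2_or_0 n.
  by rewrite !inE; apply: (sumset_leq pow2_or_0_0).
exists (fun k => if k \in sumset pow2_or_0 m then x k else 0); split.
  exists t => // k _; case: ifP => [/set_mem/xt//|_]; lia.
rewrite (_ : (fun N => _) = dyadic_sum (mem (sumset pow2_or_0 m)) x)//.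
by apply/funext => N; exact: dyadic_sum_widen.
Qed.

Lemma A_subr n a b : A_ R n a -> A_ R n b -> A_ R n (a - b).
Proof.
move=> [x [[t t0 xt] xa]] [y [[u u0 yu] yb]].
exists (fun k => x k - y k); split.
  exists (t + u)%N; first by rewrite addn_gt0 t0.
  by move=> k nk; move: (xt _ nk) (yu _ nk); lia.
rewrite (_ : (fun N => _) = (fun N =>
  dyadic_sum (mem (sumset pow2_or_0 n)) x N -
  dyadic_sum (mem (sumset pow2_or_0 n)) y N)); first exact: cvgB.
by apply/funext => N; rewrite -dyadic_sumB.
Qed.

Lemma A_union_zmod_closed : GRing.zmod_closed [in A_union R].
Proof.
split => [|a b].
  rewrite inE; exists 1%N => //; exists (fun=> 0); split.
    by exists 1%N => // k _; lia.
  rewrite (_ : (fun N => _) = fun=> 0); first exact: cvg_cst.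
  by apply/funext => N; rewrite big1// => k _; rewrite mul0r.
rewrite !inE => -[m m0 am] [n n0 bn].
exists (maxn m n); first by rewrite /= leq_max m0.
by apply: A_subr; [apply: A_mono am|apply: A_mono bn];
  rewrite ?leq_maxl ?leq_maxr.
Qed.

End Subgroup.

(** * Uncountability *)

Section Uncountable.
Context {R : realType}.

(* Exponents 2^(i+1) leave gaps of length at least 2, so a nonzero digit
   strictly dominates the tail after it. *)
Definition spread (e : nat -> bool) (k : nat) : int :=
  if `[< exists2 i, k = (2 ^ i.+1)%N & e i >] then 1 else 0.

Lemma spread_pow2 e i : spread e (2 ^ i.+1) = (e i)%:Z.
Proof.
rewrite /spread; case: asboolP => [[j /eqP]|H].
  by rewrite eqn_exp2l// => /eqP[->] ->.
by case E : (e i) => //; case: H; exists i.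
Qed.

Lemma spread_not_pow2 e k : (forall i, k <> (2 ^ i.+1)%N) -> spread e k = 0.
Proof. by move=> H; rewrite /spread; case: asboolP => // -[i /H]. Qed.

Lemma spread_bounds e k : 0 <= spread e k <= 1.
Proof. by rewrite /spread; case: ifP. Qed.

Let P : pred nat := mem (sumset pow2_or_0 1).

Definition spread_real (e : nat -> bool) : R :=
  limn (dyadic_sum P (spread e)).

Lemma spread_real_cvg e :
  dyadic_sum P (spread e) N @[N --> \oo] --> spread_real e.
Proof. by apply: (@dyadic_sum_cvg _ _ _ 1) => k _; exact: spread_bounds. Qed.

Lemma spread_real_A e : A_ R 1 (spread_real e).
Proof.
exists (spread e); split; last exact: spread_real_cvg.
by exists 1%N => // k _; have := spread_bounds e k; lia.
Qed.

Lemma pow2_sumset1 i : P (2 ^ i)%N.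
Proof.
rewrite /P/= inE; exists (fun=> (2 ^ i)%N); split; last by rewrite big_ord1.
by move=> _; right; exists i.
Qed.

(** At the first index [n] where [e] and [f] differ, the digits at exponent K = 2^(n+1) differ by 1
    or -1; they agree below K and at K+1. Equal limits would force 2^-K to be at most the tail bound
    2 / 2^(K+2), which is half of it. *)
Lemma spread_real_inj : injective spread_real.
Proof.
move=> e f ef; apply/funext => i0; apply/eqP/negPn/negP => ne0.
have [n ne nmin] := ex_minnP (ex_intro (fun i => e i != f i) _ ne0).
pose z k := spread e k - spread f k.
have z0 : dyadic_sum P z N @[N --> \oo] --> (0 : R).
  rewrite -(subrr (spread_real e)) [X in _ - X]ef.
  rewrite (_ : dyadic_sum P z = (fun N =>
    dyadic_sum P (spread e) N - dyadic_sum P (spread f) N)).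
    by apply: cvgB; exact: spread_real_cvg.
  by apply/funext => N; rewrite -dyadic_sumB.
set K := (2 ^ n.+1)%N.
have zsmall k : (k < K)%N -> z k = 0.
  move=> kK; have [[i ik]|H] := pselect (exists i, k = (2 ^ i.+1)%N); last first.
    by rewrite /z !spread_not_pow2// => i ik; apply: H; exists i.
  rewrite /z ik !spread_pow2; move: kK; rewrite ik ltn_exp2l// ltnS => lin.
  have /negPn/eqP -> : ~~ (e i != f i); last by rewrite subrr.
  by apply/negP => /nmin; rewrite leqNgt lin.
(* K+1 is odd, while [spread] lives on even exponents. This gap is essential: the tail bound from
   K+1 is 2 / 2^(K+1) = 2^-K, which gives no contradiction. *)
have zK1 : z K.+1 = 0.
  rewrite /z !spread_not_pow2// => i /(congr1 odd);
    by rewrite /K !expnS /= !oddM.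
have zK : `|(z K)%:~R| = 1 :> R.
  by rewrite /z !spread_pow2; move: ne; case: (e n); case: (f n);
    rewrite //= ?subr0 ?sub0r ?normrN normr1.
have zb k : P k -> - 1%:Z <= z k <= 1%:Z.
  by move=> _; rewrite /z; move: (spread_bounds e k) (spread_bounds f k); lia.
have := dyadic_lim_tail K.+2 zb z0.
rewrite !dyadic_sumS zK1 mul0r if_same addr0 pow2_sumset1.
rewrite {1}/dyadic_sum big1_seq ?add0r; last first.
  move=> k /andP[_]; rewrite mem_index_iota => /andP[_ kK].
  by rewrite zsmall// mul0r.
rewrite normrN normrM zK mul1r normfV normrX (ger0_norm (ler0n _ 2)).
rewrite !exprS mul1r !invfM.
have : 0 < (2 ^+ K)^-1 :> R by rewrite invr_gt0 exprn_gt0.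
set u := (2 ^+ K)^-1; lra.
Qed.

Lemma A_union_uncountable : ~ countable (A_union R).
Proof.
move=> /countable_injP[f finj].
have sA e : spread_real e \in A_union R.
  by rewrite inE; exists 1%N => //; exact: spread_real_A.
pose h e := f (spread_real e).
have hinj : injective h by move=> e e' /finj H; apply/spread_real_inj/H.
(* Cantor's diagonal for an injection [h] of 0-1 sequences into the naturals: [D] holds at the code
   of [e] exactly when [e] fails there, so its value at [h D] is contradictory. *)
pose D n : bool := `[< exists2 e, h e = n & ~~ e n >].
case E : (D (h D)).
  by move: (E) => /asboolP[e /hinj ->]; rewrite E.
by move: (E) => /asboolPn; apply; exists D; rewrite ?E.
Qed.

End Uncountable.

(** * Sums over images, and sets of Hausdorff measure zero *)

Lemma esum_image_le {R : realType} {T U : choiceType} (D : set T) (g : T -> U)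
    (f : U -> \bar R) : (forall u, 0 <= f u)%E ->
  (\esum_(u in g @` D) f u <= \esum_(i in D) f (g i))%E.
Proof.
move=> f0.
have [[t0 Dt0]|/set0P/negP/negPn/eqP ->] := pselect (D !=set0); last first.
  by rewrite image_set0 !esum_set0.
(* A section [h] of [g] is injective on the image, so the left side becomes a subsum of the right
   one. Equality can fail because [g] may identify indices. *)
have /choice[h hP] : forall u, exists t, (g @` D) u -> D t /\ g t = u.
  move=> u; have [[t Dt gt]|nu] := pselect ((g @` D) u); last by exists t0.
  by exists t.
have hinj : set_inj (g @` D) h.
  move=> u v; rewrite !inE => /hP[_ gu] /hP[_ gv] huv.
  by rewrite -gu -gv huv.
rewrite (eq_esum (b := fun u => f (g (h u)))); last by move=> u /hP[_ ->].
rewrite -(esum_image _ _ (f \o g) hinj) esum_mkcond [leRHS]esum_mkcond.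
apply: le_esum => t _; case: ifPn => [|_]; last by case: ifP.
by rewrite inE => -[u Du <-]; rewrite ifT// inE; case: (hP _ Du).
Qed.

Lemma esum_setT_cst {R : realType} (T : finType) (v : R) : 0 <= v ->
  \esum_(i in [set: T]) v%:E = (#|T|%:R * v)%:E.
Proof.
move=> v0; rewrite esum_fset; [|exact: finite_finset|by []].
have -> : [set: T] = [set` enum T].
  by apply/seteqP; split => // i _ /=; rewrite mem_enum.
rewrite -fsbig_seq ?enum_uniq// sumEFin big_const_seq count_predT -cardE.
by rewrite iter_addr addr0 mulr_natl.
Qed.

Section HausdorffNull.
Context {R : realType}.
Implicit Types (F : set R) (s : R).

(** Measure zero expressed by explicit covers, before any infimum or limit: the premeasure vanishes
    for every positive [delta], and countable unions reduce to choosing covers. *)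
Definition hausdorff_null s F := forall delta eps : R, 0 < delta -> 0 < eps ->
  exists2 C, delta_cover F delta C & (\esum_(B in C) (diam B `^ s) <= eps%:E)%E.

Lemma diam_ge0 (B : set R) : (0 <= diam B)%E.
Proof. by apply: ereal_sup_ubound; left. Qed.

Lemma diam_le (B : set R) (r : R) : 0 <= r ->
  (forall x y, B x -> B y -> `|x - y| <= r) -> (diam B <= r%:E)%E.
Proof.
move=> r0 Br; apply: ge_ereal_sup => _ [->|[x Bx [y By <-]]].
  by rewrite lee_fin.
by rewrite lee_fin Br.
Qed.

Lemma hausdorff_null_measure s F : hausdorff_null s F ->
  hausdorff_measure s F = 0%E.
Proof.
move=> Fnull; apply: lim_near_cst => //.
near=> delta.
apply/eqP; rewrite eq_le; apply/andP; split; last first.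
  apply: le_ereal_inf_tmp => _ [C _ <-].
  by apply: esum_ge0 => B _; exact: poweR_ge0.
apply/lee_addgt0Pr => eps eps0; rewrite add0e.
have delta0 : 0 < delta by near: delta; exact: nbhs_right_gt.
have [C FC Ce] := Fnull delta eps delta0 eps0.
by apply: ge_ereal_inf; exists (\esum_(B in C) (diam B `^ s))%E => //; exists C.
Unshelve. all: by end_near. Qed.

Lemma hausdorff_null_sub s F F' : F `<=` F' -> hausdorff_null s F' ->
  hausdorff_null s F.
Proof.
move=> FF' null delta eps d0 e0; have [C [cC FC dC] Ce] := null _ _ d0 e0.
by exists C => //; split => // x /FF'/FC.
Qed.

Lemma hausdorff_null_bigcup s (F : nat -> set R) :
  (forall i, hausdorff_null s (F i)) -> hausdorff_null s (\bigcup_i F i).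
Proof.
move=> Fnull delta eps d0 e0.
have /choice[C CP] : forall i, exists C, delta_cover (F i) delta C /\
    (\esum_(B in C) (diam B `^ s) <= (eps / (2 ^ i.+1)%:R)%:E)%E.
  move=> i; have [|C ? ?] := Fnull i delta (eps / (2 ^ i.+1)%:R) d0.
    by rewrite divr_gt0// ltr0n expn_gt0.
  by exists C.
(* The union of the covers is taken as an image of their disjoint union, so that the iterated sum is
   a sum over pairs and sets shared by several covers only lower the total. *)
exists (snd @` ([set: nat] `*`` C)); first split.
- apply: (sub_countable (card_image_le _ _)).
  rewrite (_ : _ `*`` _ = \bigcup_i (pair i @` C i)).
    apply: bigcup_countable => // i _; apply: sub_countable (card_image_le _ _) _.
    by case: (CP i) => -[].
  apply/seteqP; split => [[i B] [_ CB]|_ [i _ [B CB <-]]] //.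
  by exists i => //; exists B.
- move=> x [i _ Fix]; have [[_ /(_ _ Fix)[B CB Bx] _] _] := CP i.
  by exists B => //; exists (i, B).
- by move=> _ [[i B] [_ CB] <-]; have [[_ _ dC] _] := CP i; exact: dC.
apply: le_trans (epsilon_trick0 xpredT (ltW e0)).
rewrite nneseries_esumT; last first.
  by move=> i; rewrite lee_fin divr_ge0// ltW.
apply: (@le_trans _ _ (\esum_(i in [set: nat]) \esum_(B in C i) (diam B `^ s))%E).
  2: by apply: le_esum => i _; exact: (CP i).2.
rewrite esum_esum; last by move=> *; exact: poweR_ge0.
by apply: esum_image_le => B; exact: poweR_ge0.
Qed.

Lemma delta_cover_balls s F (T : finType) (c : T -> R) (r delta : R) :
  0 <= s -> 0 <= r -> r *+ 2 <= delta ->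
  (forall a, F a -> exists d, `|a - c d| <= r) ->
  exists2 C, delta_cover F delta C &
    (\esum_(B in C) (diam B `^ s) <= (#|T|%:R * (r *+ 2) `^ s)%:E)%E.
Proof.
move=> s0 r0 rd Fc; pose ball d := [set a | `|a - c d| <= r].
have r20 : 0 <= r *+ 2 by rewrite mulrn_wge0.
have dB d : (diam (ball d) <= (r *+ 2)%:E)%E.
  apply: diam_le => // x y; rewrite /ball/= => xd yd.
  by rewrite mulr2n (le_trans (ler_distD (c d) _ _))// lerD// distrC.
exists (range ball); first split.
- by apply: sub_countable (card_image_le _ _) (finite_set_countable finite_finset).
- by move=> a /Fc[d ad]; exists (ball d) => //; exists d.
- by move=> _ [d _ <-]; rewrite (le_trans (dB d))// lee_fin.
apply: le_trans (esum_image_le _ _ _) _; first by move=> B; exact: poweR_ge0.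
rewrite -esum_setT_cst ?powR_ge0//; apply: le_esum => d _.
rewrite -poweR_EFin; apply: gt0_ler_poweR => //.
- by rewrite in_itv/= diam_ge0 leey.
- by rewrite in_itv/= lee_fin r20 leey.
Qed.

End HausdorffNull.

(** * Counting and covering by small balls *)

Lemma polynomial_le_exp2 c n : exists m, (c * m.+1 ^ n <= 2 ^ m)%N.
Proof.
have sq a : (a * (2 * a).+1 <= 2 ^ (2 * a))%N.
  elim: a => [|[|a] IH]//; move: IH.
  rewrite [(2 * a.+2)%N](_ : _ = (2 * a.+1).+2)%N; last lia.
  by rewrite !expnS; nia.
(* With m+1 = 2^j, and c <= 2^c, the claim reduces to c + j n < 2^j. This follows from a (j+1) <=
   2^j, which is [sq a]. *)
pose a := (c + n).+1; pose j := (2 * a)%N.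
exists (2 ^ j).-1; rewrite prednK ?expn_gt0//.
apply: (@leq_trans (2 ^ (c + j * n))).
  by rewrite expnD expnM leq_mul2r ltnW ?orbT// ltn_expl.
rewrite leq_exp2l//.
by have := sq a; rewrite -/j /j /a; nia.
Qed.

(* The 2^(-2^m) decay of the radii beats the exponentially growing number of
   balls, as the exponent of the latter is only polynomial in m. *)
Lemma ball_count_decay {R : realType} (n t : nat) (s delta eps : R) :
  0 < s -> 0 < delta -> 0 < eps ->
  exists m, let r := t%:R * (2 / 2 ^+ (2 ^ m)) in
    r *+ 2 <= delta /\
    ((2 * t).+1 ^ (m.+1 ^ n))%:R * (r *+ 2) `^ s <= eps.
Proof.
move=> s0 d0 e0.
(* [L] is the numerator of the diameter bound 2r = L / 2^(2^m), and 2^(L W) with W = (m+1)^n also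
   bounds the number of balls. The exponent [q] compensates for [s], and 2^-u is at most both
   [delta] and [eps]. *)
pose L := (4 * t)%N.
pose q := (Num.truncn s^-1).+1.
have qs : 1 <= q%:R * s.
  by rewrite -ler_pdivrMr// mul1r ltW// truncnS_gt.
pose mn := Num.min delta eps.
have mn0 : 0 < mn by rewrite lt_min d0.
pose u := (Num.truncn mn^-1).+1.
have un : 2^-1 ^+ u <= mn.
  rewrite exprVn -[leRHS]invrK lef_pV2 ?posrE ?invr_gt0 ?exprn_gt0//.
  rewrite (le_trans (ltW (truncnS_gt _)))// -/u -natrX ler_nat ltnW//.
  exact: ltn_expl.
(* The aim is q (L W + u) + L + u <= 2^m; since W >= 1, multiplying every coefficient by W covers
   it. *)
have [m mP] := polynomial_le_exp2 (q * L + q * u + L + u) n.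
exists m => /=.
set W := (m.+1 ^ n)%N in mP *.
have W0 : (0 < W)%N by rewrite expn_gt0.
set E := (2 ^ m)%N in mP *.
have mP' : (q * (L * W + u) + L + u <= E)%N.
  apply: leq_trans mP; nia.
set r2 := _ *+ 2.
have r20 : 0 <= r2.
  by rewrite mulrn_wge0// mulr_ge0// divr_ge0// exprn_ge0.
have h0 : 0 < 2^-1 :> R by [].
have h1 : 2^-1 <= 1 :> R by rewrite invf_le1// ler1n.
have r2E b : (b + L <= E)%N -> r2 <= 2^-1 ^+ b.
  move=> bE; rewrite /r2.
  have -> : t%:R * (2 / 2 ^+ E) *+ 2 = L%:R / 2 ^+ E :> R.
    by rewrite /L natrM mulr2n; ring.
  rewrite ler_pdivrMr ?exprn_gt0// exprVn mulrC ler_pdivlMr ?exprn_gt0//.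
  rewrite -!natrX -natrM ler_nat.
  apply: (@leq_trans (2 ^ (b + L))); last by rewrite leq_exp2l.
  by rewrite expnD mulnC leq_mul2l ltnW ?orbT// ltn_expl.
split.
  apply: (le_trans (r2E u _)); first by move: mP'; lia.
  by rewrite (le_trans un)// ge_min lexx.
(* The diameter bound is at most y^q, and q s >= 1 with y <= 1 makes its [s]-th power at most y. The
   factor 2^(L W) then cancels, leaving 2^-u. *)
set y : R := 2^-1 ^+ (L * W + u).
have y0 : 0 < y by rewrite exprn_gt0.
have y0' := ltW y0.
have y1 : y <= 1 by rewrite exprn_ile1// ltW.
have r2s : r2 `^ s <= y.
  apply: (@le_trans _ _ ((y ^+ q) `^ s)).
    apply: ge0_ler_powR; rewrite ?nnegrE ?exprn_ge0//; first exact: ltW.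
    by rewrite /y -exprM r2E//; move: mP'; rewrite mulnC; lia.
  rewrite -powR_mulrn// -powRrM -[leRHS](@powRr1 _ y)//.
  by apply: ger_powR => //; rewrite y0.
apply: (@le_trans _ _ (2 ^+ (L * W) * y)).
  apply: ler_pM => //; first exact: powR_ge0.
  rewrite -natrX ler_nat expnM leq_exp2r//.
  by apply: (@leq_trans (2 ^ (2 * t))); [exact: ltn_expl|rewrite leq_exp2l// /L; lia].
rewrite /y exprD mulrA -exprMn divff// expr1n mul1r.
by rewrite (le_trans un)// ge_min lexx orbT.
Qed.

(** Code 0 stands for the summand 0 and code j+1 for 2^j. Each summand is at most k < 2^m, so its
    exponent is below m and m+1 codes suffice. *)
Lemma sumset_pow2_code n m k : sumset pow2_or_0 n k -> (k < 2 ^ m)%N ->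
  exists g : {ffun 'I_n -> 'I_m.+1},
    (\sum_i (if nat_of_ord (g i) is j.+1 then 2 ^ j else 0))%N = k.
Proof.
move=> [s [sS ->]] km.
have /choice[h hP] : forall i, exists j : 'I_m.+1,
    (if nat_of_ord j is j'.+1 then 2 ^ j' else 0)%N = s i.
  move=> i; have [->|[l sl]] := sS i; first by exists ord0.
  have lm : (l.+1 < m.+1)%N.
    rewrite ltnS -(@ltn_exp2l 2)// -sl (leq_ltn_trans _ km)//.
    by rewrite (bigD1 i)//= leq_addr.
  by exists (Ordinal lm).
exists (finfun h); apply: eq_bigr => i _; rewrite ffunE; exact: hP.
Qed.

Section HausdorffDim.
Context {R : realType}.

(** Fixing the digit bound splits the union into countably many pieces, each with finite covers at
    every scale. *)
Definition A_bounded (n t : nat) : set R :=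
  [set a | exists2 x : nat -> int,
     (forall k, sumset pow2_or_0 n k -> - t%:Z <= x k <= t%:Z) &
     dyadic_sum (mem (sumset pow2_or_0 n)) x N @[N --> \oo] --> a].

(** The centers are the truncations at 2^m. Indexing digits by codes rather than by exponents makes
    the size of the index type the required count. *)
Lemma A_bounded_balls n t m :
  exists c : {ffun {ffun 'I_n -> 'I_m.+1} -> 'I_(2 * t).+1} -> R,
  forall a, A_bounded n t a ->
    exists d, `|a - c d| <= t%:R * (2 / 2 ^+ (2 ^ m)).
Proof.
set P : pred nat := mem (sumset pow2_or_0 n).
pose sigma (g : {ffun 'I_n -> 'I_m.+1}) : nat :=
  (\sum_i (if nat_of_ord (g i) is j.+1 then 2 ^ j else 0))%N.
have /choice[rho rhoP] : forall k, exists g,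
    P k -> (k < 2 ^ m)%N -> sigma g = k.
  move=> k; have [[Pk km]|H] := pselect (P k /\ (k < 2 ^ m)%N).
    by move: Pk; rewrite /P/= inE => /sumset_pow2_code/(_ km)[g gk]; exists g.
  by exists [ffun=> ord0] => Pk km; case: H.
exists (fun d : {ffun _} =>
  dyadic_sum P (fun k => (nat_of_ord (d (rho k)))%:Z - t%:Z) (2 ^ m)).
move=> a [x xt xa].
have xt' k : P k -> - t%:Z <= x k <= t%:Z by rewrite /P/= inE => /xt.
(* Adding [t] moves a digit from [-t,t] to [0,2t]; only the values at the chosen codes [rho k] are
   read back. *)
exists [ffun g => inord (absz (x (sigma g) + t%:Z)%R)].
rewrite (_ : dyadic_sum _ _ _ = dyadic_sum P x (2 ^ m)).
  exact: dyadic_lim_tail.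
rewrite /dyadic_sum big_mkcond [RHS]big_mkcond.
apply: eq_big_nat => k /andP[_ km]; case: ifP => // Pk; congr (_%:~R / _).
by rewrite ffunE (rhoP k)// inordK; move: (xt' k Pk); lia.
Qed.

Lemma A_union_hausdorff_null s : 0 < s -> hausdorff_null s (A_union R).
Proof.
move=> s0.
apply: (@hausdorff_null_sub _ _ _ (\bigcup_n \bigcup_t A_bounded n t)).
  move=> a [n _ [x [[t _ xt] xa]]].
  by exists n => //; exists t => //; exists x.
apply: hausdorff_null_bigcup => n; apply: hausdorff_null_bigcup => t.
move=> delta eps d0 e0.
have [m [rd re]] := ball_count_decay n t s0 d0 e0.
have [c cP] := A_bounded_balls n t m.
have [|C AC Ce] := delta_cover_balls (ltW s0) _ rd cP.
  by rewrite mulr_ge0// divr_ge0// exprn_ge0.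
exists C => //; apply: (le_trans Ce); rewrite lee_fin.
by move: re; rewrite card_ffun card_ord card_ffun !card_ord.
Qed.

End HausdorffDim.

Unset Implicit Arguments.

Theorem mainTheorem1 (R : realType) :
  [/\ ~ countable (A_union R),
      GRing.zmod_closed [in A_union R] &
      has_hausdorff_dim (A_union R) 0].
Proof.
split; [exact: A_union_uncountable|exact: A_union_zmod_closed|split].
- by rewrite lexx ler01.
- by move=> s /andP[s0]; rewrite ltNge s0.
- by move=> s s0; apply/hausdorff_null_measure/A_union_hausdorff_null.
Qed.
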